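(* Let $K$ be a field. The formula $H_p(G)=\operatorname{Ker}(\partial|_{\Omega_p(G)})/\operatorname{Im}(\partial|_{\Omega_{p+1}(G)})$ defines a functor from the category of digraphs to the category of abelian groups, where a digraph homomorphism $\psi: G_1\to G_2$ acts on homology through the $K$-linear map $e_{i_0,\dots,i_p}\mapsto e_{\psi(i_0),\dots,\psi(i_p)}$.
   Context: A digraph is a pair $G=(V,E)$ with $V$ a finite set and $E\subseteq V\times V$. A homomorphism of digraphs $\psi: G_1\to G_2$ is a map sending vertices to vertices and arcs to arcs, compatible with taking initial vertices and end vertices of arcs; that is, $(\psi(u),\psi(v))$ is an arc of $G_2$ whenever $(u,v)$ is an arc of $G_1$. For $p\ge 0$, $\Lambda_p=\Lambda_p(V)$ is the free $K$-module with basis the elementary $p$-paths $e_{i_0,\dots,i_p}$, one for each sequence $i_0,\dots,i_p$ of $p+1$ vertices in $V$. The boundary operator $\partial:\Lambda_p\to\Lambda_{p-1}$ is the $K$-linear map with $\partial e_{i_0,\dots,i_p}=\sum_{q=0}^p(-1)^q e_{i_0\dots\widehat{i_q}\dots i_p}$ for $p\ge1$, where the hat means omission, and $\partial=0$ on $\Lambda_0$ (with $\Lambda_{-1}=0$); one has $\partial^2=0$. An elementary path $e_{i_0,\dots,i_p}$ is regular if $i_k\ne i_{k+1}$ for all $k$; a regular elementary path is allowed if $(i_k,i_{k+1})\in E$ for all $k=0,\dots,p-1$. $A_p=A_p(G)\subseteq\Lambda_p$ is the submodule generated by the allowed elementary $p$-paths (with $A_{-1}=0$). Define $\Omega_p=\Omega_p(G)=\{v\in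 A_p:\partial v\in A_{p-1}\}$; then $\partial\Omega_p\subseteq\Omega_{p-1}$, so $(\Omega_p,\partial)$ is a chain complex.
   Formalization: The category of digraphs is restricted to digraphs without loops; with loops the claim fails, since a homomorphism may collapse an arc onto a loop and send a cycle to a chain containing the non-regular path e_aa, which is not in A_1. *)

(* Defs.v *)
From HB Require Import structures.
From mathcomp Require Import all_boot all_algebra ring_quotient.
From mathcomp Require Import boolp.

Set Implicit Arguments.
Unset Strict Implicit.
Unset Printing Implicit Defensive.

Import GRing.Theory.

Local Open Scope ring_scope.
Local Open Scope quotient_scope.

Record category := Category {
  ob :> Type;
  mor : ob -> ob -> Type;
  idmor : forall A, mor A A;
  compmor : forall A B C, mor B C -> mor A B -> mor A C;
  compmor_idl : forall A B (f : mor A B), compmor (idmor B) f = f;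
  compmor_idr : forall A B (f : mor A B), compmor f (idmor A) = f;
  compmor_assoc : forall A B C D (h : mor C D) (g : mor B C) (f : mor A B),
    compmor h (compmor g f) = compmor (compmor h g) f
}.

(* Functors with a prescribed action on objects. *)
Record functor_on (C D : category) (F : C -> D) := FunctorOn {
  fmap : forall A B : C, mor A B -> mor (F A) (F B);
  fmap_id : forall A : C, fmap (idmor A) = idmor (F A);
  fmap_comp : forall (A B E : C) (g : mor B E) (f : mor A B),
    fmap (compmor g f) = compmor (fmap g) (fmap f)
}.

Definition full_subcategory (C : category) (P : C -> Prop) : category :=
  @Category {A : C | P A}
    (fun A B => mor (sval A) (sval B))
    (fun A => idmor (sval A))
    (fun A B E g f => compmor g f)
    (fun A B f => compmor_idl f)
    (fun A B f => compmor_idr f)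
    (fun A B E D h g f => compmor_assoc h g f).

Lemma eq_additive (U V : zmodType) (f g : {additive U -> V}) :
  f =1 g -> f = g.
Proof.
move=> /funext; case: f g => f cf [g cg] /= fg; move: cg; rewrite -{}fg => cg.
congr Algebra.Additive.Pack; case: cf cg => [[f0]] [[g0]].
by rewrite (Prop_irrelevance g0 f0).
Qed.

Definition Ab : category :=
  @Category zmodType (fun U V => {additive U -> V})
    (fun U => idfun : {additive U -> U})
    (fun U V W g f => (g \o f : {additive U -> W}))
    (fun U V f => @eq_additive U V (idfun \o f) f (fun _ => erefl))
    (fun U V f => @eq_additive U V (f \o idfun) f (fun _ => erefl))
    (fun U V W X h g f =>
       @eq_additive U X (h \o (g \o f)) ((h \o g) \o f) (fun _ => erefl)).

Record digraph := Digraph { vertex :> finType; arc : rel vertex }.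

Record digraph_hom (G1 G2 : digraph) := DigraphHom {
  hom_fun :> G1 -> G2;
  hom_arc : forall u v, arc u v -> arc (hom_fun u) (hom_fun v)
}.

Definition Digr : category :=
  @Category digraph digraph_hom
    (fun G => @DigraphHom G G id (fun u v a => a))
    (fun G1 G2 G3 g f =>
       @DigraphHom G1 G3 (g \o f) (fun u v a => hom_arc g (hom_arc f a)))
    (fun _ _ => fun '(DigraphHom _ _) => erefl)
    (fun _ _ => fun '(DigraphHom _ _) => erefl)
    (fun _ _ _ _ _ _ _ => erefl).

(* Functoriality needs loopless digraphs: elementary paths with two equal
   consecutive vertices are never allowed, so an arc must not be collapsed onto
   a loop. For instance, the 1-cycle e_01 + e_12 + e_20 of a directed triangle
   would be sent by 0, 1 |-> a and 2 |-> b to e_aa + e_ab + e_ba, which is not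
   in A_1, when the target has the arcs aa, ab and ba. *)
Definition loopless (G : Digr) : Prop := irreflexive (@arc G).

Definition LooplessDigr : category := full_subcategory loopless.

Section PathHomology.
Variable K : fieldType.

Definition path_space (V : finType) (p : nat) : vectType K :=
  {ffun p.+1.-tuple V -> K^o}.

Definition epath (V : finType) p (i : p.+1.-tuple V) : path_space V p :=
  [ffun j => (j == i)%:R].

Definition lin_ext (V : finType) p (W : vectType K)
    (f : p.+1.-tuple V -> W) : path_space V p -> W :=
  fun v => \sum_i (v i : K) *: f i.

Lemma lin_ext_is_linear (V : finType) p (W : vectType K)
  (f : p.+1.-tuple V -> W) : linear (lin_ext f).
Proof.
move=> a u v; rewrite /lin_ext scaler_sumr -big_split /=.
by apply: eq_bigr => i _; rewrite !ffunE scalerDl scalerA.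
Qed.

HB.instance Definition _ (V : finType) p (W : vectType K)
    (f : p.+1.-tuple V -> W) :=
  GRing.isLinear.Build K (path_space V p) W *:%R (lin_ext f)
    (lin_ext_is_linear f).

Definition omit (V : finType) p (q : 'I_p.+2) (i : p.+2.-tuple V) :
    p.+1.-tuple V :=
  [tuple tnth i (lift q k) | k < p.+1].

(* On [path_space V 0] the boundary is zero, so its codomain there, nominally
   [path_space V 0.-1], stands for the zero module of (-1)-paths. *)
Definition boundary (V : finType) p :
    'Hom(path_space V p, path_space V p.-1) :=
  match p with
  | 0 => 0
  | p'.+1 => linfun (lin_ext (fun i : p'.+2.-tuple V =>
      \sum_(q < p'.+2) (-1) ^+ q *: epath (omit q i)))
  end.

Definition regular_path (V : finType) p (i : p.+1.-tuple V) : bool :=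
  sorted (fun u v => u != v) i.

Definition allowed_path (G : digraph) p (i : p.+1.-tuple G) : bool :=
  regular_path i && sorted (@arc G) i.

Definition allowed_space (G : digraph) p : {vspace path_space G p} :=
  <<[seq epath i | i in @allowed_path G p]>>%VS.

(* For p = 0 the constraint is [0 \in allowed_space G 0], which is vacuous. *)
Definition Omega (G : digraph) p : {vspace path_space G p} :=
  (allowed_space G p :&: boundary G p @^-1: allowed_space G p.-1)%VS.

Definition cycles (G : digraph) p : {vspace path_space G p} :=
  (Omega G p :&: lker (boundary G p))%VS.

Definition boundaries (G : digraph) p : {vspace path_space G p} :=
  (boundary G p.+1 @: Omega G p.+1)%VS.

(* Since two successive boundaries compose to 0, [boundaries] lies in [cycles];
   [bounding] is that subspace seen inside the type of cycles, and the quotient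
   below is Ker / Im. *)
Definition bounding (G : digraph) p : {pred subvs_of (cycles G p)} :=
  fun z => vsval z \in boundaries G p.

Lemma bounding_closed G p : zmod_closed (@bounding G p).
Proof.
have boundingE z : (z \in @bounding G p) = (vsval z \in boundaries G p) by [].
split=> [|x y]; rewrite !boundingE ?linear0 ?mem0v // linearB.
exact: rpredB.
Qed.

HB.instance Definition _ G p :=
  GRing.isZmodClosed.Build (subvs_of (cycles G p)) (@bounding G p)
    (bounding_closed G p).

Definition path_homology (G : digraph) (p : nat) : zmodType :=
  Quotient.quot (@bounding G p).

Definition homology_class (G : digraph) p (z : subvs_of (cycles G p)) :
    path_homology G p :=
  \pi_(Quotient.quot (@bounding G p)) z.

Definition pushforward (V1 V2 : finType) (f : V1 -> V2) p :
    'Hom(path_space V1 p, path_space V2 p) :=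
  linfun (lin_ext (fun i : p.+1.-tuple V1 => epath (map_tuple f i))).

End PathHomology.

(* Main.v *)
Require Import Defs.
From HB Require Import structures.
From mathcomp Require Import all_boot all_algebra ring_quotient.

Set Implicit Arguments.
Unset Strict Implicit.
Unset Printing Implicit Defensive.

(** The pushforward along a vertex map sends basis paths to basis paths, so it
    commutes with the operators that delete one vertex, hence with the boundary
    ([boundary_pushforward]), and it respects identities and composites.

    For a digraph homomorphism it also preserves the allowed paths: arcs go to
    arcs by definition, and when the target has no loop the two ends of an arc
    are distinct, so the image path is regular as well ([map_allowed_path]).
    These two facts make the pushforward preserve [Omega], which is cut out by
    conditions on v and on its boundary, and therefore cycles and boundaries.

    The pushforward thus descends to homology classes ([homology_map_class]).
    Every class is the class of some cycle, so additivity and the two functor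
    laws can be checked on cycles, where they are the corresponding properties
    of the pushforward. *)

Import GRing.Theory.

Local Open Scope ring_scope.
Local Open Scope quotient_scope.

Section Pushforward.
Variable K : fieldType.

Lemma lin_ext_epath (V : finType) p (W : vectType K)
    (f : p.+1.-tuple V -> W) i : lin_ext f (epath K i) = f i.
Proof.
rewrite /lin_ext (bigD1 i) //= ffunE eqxx scale1r big1 ?addr0 // => j ji.
by rewrite ffunE (negPf ji) scale0r.
Qed.

Lemma path_sum_epath (V : finType) p (v : path_space K V p) :
  v = \sum_i (v i : K) *: epath K i.
Proof.
apply/ffunP => j; rewrite sum_ffunE (bigD1 j) //= !ffunE eqxx big1 ?addr0.
  by rewrite /GRing.scale /= mulr1.
by move=> i ij; rewrite !ffunE eq_sym (negPf ij) scaler0.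
Qed.

(** All identities between linear maps of path spaces are reduced to basis
    paths through this lemma. *)
Lemma eq_on_epath (V : finType) p (W : vectType K)
    (f g : 'Hom(path_space K V p, W)) :
  (forall i, f (epath K i) = g (epath K i)) -> f = g.
Proof.
move=> fg; apply/lfunP => v; rewrite (path_sum_epath v) !linear_sum.
by apply: eq_bigr => i _; rewrite !linearZ /= fg.
Qed.

Lemma pushforward_epath (V1 V2 : finType) (f : V1 -> V2) p i :
  pushforward K f p (epath K i) = epath K (map_tuple f i).
Proof. by rewrite lfunE /= lin_ext_epath. Qed.

Lemma pushforward_id (V : finType) p : pushforward K (@id V) p = \1%VF.
Proof.
apply: eq_on_epath => i; rewrite pushforward_epath id_lfunE.
by congr epath; apply: val_inj; rewrite /= map_id.
Qed.

Lemma pushforward_comp (V1 V2 V3 : finType) (g : V2 -> V3) (f : V1 -> V2) p :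
  pushforward K (g \o f) p = (pushforward K g p \o pushforward K f p)%VF.
Proof.
apply: eq_on_epath => i; rewrite comp_lfunE !pushforward_epath.
by congr epath; apply: val_inj; rewrite /= map_comp.
Qed.

Lemma map_omit (V1 V2 : finType) (f : V1 -> V2) p (q : 'I_p.+2)
    (i : p.+2.-tuple V1) :
  map_tuple f (omit q i) = omit q (map_tuple f i).
Proof. by apply: eq_from_tnth => k; rewrite !(tnth_map, tnth_mktuple). Qed.

(** The pushforward is a chain map on all paths, since applying a vertex map
    commutes with omitting a vertex. *)
Lemma boundary_pushforward (V1 V2 : finType) (f : V1 -> V2) p :
  (boundary K V2 p \o pushforward K f p =
   pushforward K f p.-1 \o boundary K V1 p)%VF.
Proof.
case: p => [|p]; first by rewrite /= comp_lfun0l comp_lfun0r.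
apply: eq_on_epath => i; rewrite !comp_lfunE pushforward_epath /=.
rewrite !lfunE /= !lin_ext_epath linear_sum.
apply: eq_bigr => q _.
by rewrite linearZ /= lin_ext_epath map_omit.
Qed.

End Pushforward.

Section DigraphHom.
Variables (K : fieldType) (G1 G2 : digraph) (psi : digraph_hom G1 G2).
Hypothesis G2_loopless : loopless G2.

(** Looplessness of the target enters here only: it prevents an arc from being
    collapsed to a repeated vertex, which would make the image path
    irregular. *)
Lemma map_allowed_path p (i : p.+1.-tuple G1) :
  allowed_path i -> allowed_path (map_tuple psi i).
Proof.
case/andP=> _ arc_i.
have arc_psi_i : sorted (@Defs.arc G2) (map_tuple psi i).
  by apply: homo_sorted arc_i => u v; apply: hom_arc.
rewrite /allowed_path arc_psi_i andbT.
apply: sub_sorted arc_psi_i => u v; apply: contraTneq => ->.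
by rewrite G2_loopless.
Qed.

Lemma pushforward_allowed p :
  (pushforward K psi p @: allowed_space K G1 p <= allowed_space K G2 p)%VS.
Proof.
rewrite limg_span; apply/span_subvP => _ /mapP[_ /imageP[i i_allowed ->] ->].
rewrite pushforward_epath memv_span //; apply/imageP.
by exists (map_tuple psi i); first exact: map_allowed_path.
Qed.

Lemma boundary_pushforwardE p v :
  boundary K G2 p (pushforward K psi p v) =
  pushforward K psi p.-1 (boundary K G1 p v).
Proof. by rewrite -!comp_lfunE boundary_pushforward. Qed.

(** The boundary condition in [Omega] passes to the image because the
    pushforward both commutes with the boundary and preserves allowed chains,
    in degrees p and p - 1. *)
Lemma pushforward_Omega p :
  (pushforward K psi p @: Omega K G1 p <= Omega K G2 p)%VS.
Proof.
apply/subvP => w /memv_imgP[v v_Omega ->{w}]; move: v_Omega.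
rewrite !memv_cap -!memv_preim => /andP[v_allowed dv_allowed].
rewrite (subvP (pushforward_allowed p)) ?memv_img //=.
by rewrite boundary_pushforwardE (subvP (pushforward_allowed _)) ?memv_img.
Qed.

Lemma pushforward_cycles p :
  (pushforward K psi p @: cycles K G1 p <= cycles K G2 p)%VS.
Proof.
apply/subvP => w /memv_imgP[v v_cycle ->{w}]; move: v_cycle.
rewrite ![_ \in cycles _ _ _]memv_cap !memv_ker => /andP[v_Omega /eqP dv0].
rewrite (subvP (pushforward_Omega p)) ?memv_img //=.
by rewrite boundary_pushforwardE dv0 linear0.
Qed.

Lemma pushforward_boundaries p :
  (pushforward K psi p @: boundaries K G1 p <= boundaries K G2 p)%VS.
Proof.
rewrite -limg_comp -boundary_pushforward limg_comp.
exact/limgS/pushforward_Omega.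
Qed.

End DigraphHom.

Section HomologyMap.
Variables (K : fieldType) (p : nat).

Lemma homology_class_eq (G : digraph) (z w : subvs_of (cycles K G p)) :
  (homology_class z == homology_class w) =
  (vsval z - vsval w \in boundaries K G p).
Proof.
rewrite -linearB -[RHS]/(z - w \in @bounding K G p).
exact/esym/Quotient.idealrBE.
Qed.

Lemma homology_classK (G : digraph) (x : path_homology K G p) :
  homology_class (repr x) = x.
Proof. exact: reprK. Qed.

Section Map.
Variables (G1 G2 : LooplessDigr) (psi : mor G1 G2).

(** [vsproj] is a total linear projection; by [vsval_cycle_map] the vector to
    which it is applied is already a cycle, so nothing is lost. *)
Definition cycle_map (z : subvs_of (cycles K (sval G1) p)) :=
  vsproj (cycles K (sval G2) p) (pushforward K (hom_fun psi) p (vsval z)).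

Lemma vsval_cycle_map z :
  vsval (cycle_map z) = pushforward K (hom_fun psi) p (vsval z).
Proof.
apply: vsprojK; apply: (subvP (pushforward_cycles K psi (svalP G2) p)).
exact/memv_img/subvsP.
Qed.

Definition homology_map (x : path_homology K (sval G1) p) :
    path_homology K (sval G2) p :=
  homology_class (cycle_map (repr x)).

(** The definition picks a representative; the choice is immaterial because two
    representatives differ by a boundary, whose pushforward is a boundary. *)
Lemma homology_map_class z :
  homology_map (homology_class z) = homology_class (cycle_map z).
Proof.
apply/eqP; rewrite homology_class_eq !vsval_cycle_map -linearB.
apply: (subvP (pushforward_boundaries K psi (svalP G2) p)); apply: memv_img.
by rewrite -homology_class_eq homology_classK.
Qed.

Lemma homology_map_is_zmod_morphism : zmod_morphism homology_map.
Proof.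
move=> x y; rewrite -[x]homology_classK -[y]homology_classK.
have classB G (z w : subvs_of (cycles K G p)) :
  homology_class z - homology_class w = homology_class (z - w).
  by rewrite /homology_class raddfB.
rewrite classB !homology_map_class classB; congr homology_class.
by apply: val_inj; rewrite /= !(linearB, vsval_cycle_map).
Qed.

HB.instance Definition _ :=
  GRing.isZmodMorphism.Build (path_homology K (sval G1) p)
    (path_homology K (sval G2) p) homology_map homology_map_is_zmod_morphism.

End Map.

Lemma homology_map_id (G : LooplessDigr) : homology_map (idmor G) =1 id.
Proof.
move=> x; rewrite -[x]homology_classK homology_map_class.
congr homology_class; apply: val_inj.
by rewrite /= vsval_cycle_map pushforward_id id_lfunE.
Qed.

Lemma homology_map_comp (G1 G2 G3 : LooplessDigr)
    (psi : mor G2 G3) (phi : mor G1 G2) :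
  homology_map (compmor psi phi) =1 homology_map psi \o homology_map phi.
Proof.
move=> x; rewrite -[x]homology_classK /=.
rewrite (homology_map_class phi) !homology_map_class.
congr homology_class; apply: val_inj.
by rewrite /= !vsval_cycle_map pushforward_comp comp_lfunE.
Qed.

Definition homology_functor :
    @functor_on LooplessDigr Ab (fun G => path_homology K (sval G) p) :=
  @FunctorOn LooplessDigr Ab _
    (fun G1 G2 (psi : mor G1 G2) =>
       homology_map psi : {additive path_homology K (sval G1) p ->
                                    path_homology K (sval G2) p})
    (fun G => @eq_additive _ _ (homology_map (idmor G)) idfun
       (@homology_map_id G))
    (fun G1 G2 G3 psi phi => @eq_additive _ _
       (homology_map (compmor psi phi)) (homology_map psi \o homology_map phi)
       (homology_map_comp psi phi)).

End HomologyMap.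

Theorem theorem2p7 (K : fieldType) (p : nat) :
  exists H : @functor_on LooplessDigr Ab (fun G => path_homology K (sval G) p),
    forall (G1 G2 : LooplessDigr) (psi : mor G1 G2)
           (z : subvs_of (cycles K (sval G1) p)),
      exists2 w : subvs_of (cycles K (sval G2) p),
        vsval w = pushforward K (hom_fun psi) p (vsval z)
        & fmap H psi (homology_class z) = homology_class w.
Proof.
exists (homology_functor K p) => G1 G2 psi z; exists (cycle_map psi z).
  exact: vsval_cycle_map.
exact: homology_map_class.
Qed.
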